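(* Let $X$ and $Y$ be infinite Tychonoff spaces with $Y$ compact. Then the space $C_p(X,C(Y))$ is isomorphic to the space $C_p(X,C(Y))\times\mathbb{R}$.
   Context: $C(Y)$ is the Banach space of continuous real-valued functions on the compact space $Y$ with the supremum norm. For a locally convex space $E$, $C_p(X,E)$ is the space of all continuous functions $X\to E$ with the pointwise topology (inherited from the product $E^X$). Tychonoff means completely regular and Hausdorff. Isomorphic means linearly homeomorphic. *)

(* Defs.v *)
From HB Require Import structures.
From mathcomp Require Import all_boot all_order all_algebra.
From mathcomp Require Import all_classical all_reals all_analysis.

Set Implicit Arguments.
Unset Strict Implicit.
Unset Printing Implicit Defensive.

Import Order.TTheory GRing.Theory Num.Theory.
Import numFieldNormedType.Exports.

Local Open Scope classical_set_scope.
Local Open Scope ring_scope.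

(* By uniform_separatorP, completely_regular_space is the usual separation of
   points from closed sets by continuous [0, 1]-valued functions. *)
Definition tychonoff_space (T : topologicalType) : Prop :=
  completely_regular_space T /\ hausdorff_space T.

Section continuous_zmodule.
Context {X : topologicalType} {E : topologicalZmodType}.
Implicit Types f g h : continuousType X E.

Let add_cts f g : continuous (f \+ g).
Proof.
move=> x; apply: (@continuous2_cvg _ _ _ _ _ _ f g +%R (f x) (g x)).
- exact: (@add_continuous E (f x, g x)).
- exact: cts_fun.
- exact: cts_fun.
Qed.

Let opp_cts f : continuous (\- f).
Proof.
move=> x; apply: (@continuous_comp _ _ _ f -%R); first exact: cts_fun.
exact: opp_continuous.
Qed.

Definition cts_zero : continuousType X E := cst 0.
Definition cts_add f g : continuousType X E := mkcts (@add_cts f g).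
Definition cts_opp f : continuousType X E := mkcts (@opp_cts f).

Let addA : associative cts_add.
Proof. by move=> f g h; apply/continuousEP => x; exact: addrA. Qed.
Let addC : commutative cts_add.
Proof. by move=> f g; apply/continuousEP => x; exact: addrC. Qed.
Let add0 : left_id cts_zero cts_add.
Proof. by move=> f; apply/continuousEP => x; exact: add0r. Qed.
Let addN : left_inverse cts_zero cts_opp cts_add.
Proof. by move=> f; apply/continuousEP => x; exact: addNr. Qed.

HB.instance Definition _ :=
  GRing.isZmodule.Build (continuousType X E) addA addC add0 addN.

Lemma ctsD f g x : (f + g) x = f x + g x. Proof. by []. Qed.
Lemma ctsN f x : (- f) x = - f x. Proof. by []. Qed.
Lemma cts0 x : (0 : continuousType X E) x = 0. Proof. by []. Qed.
End continuous_zmodule.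

Section continuous_lmodule.
Context {K : numDomainType} {X : topologicalType} {E : topologicalLmodType K}.
Implicit Types f g : continuousType X E.

Let scale_cts (k : K) f : continuous (k \*: f).
Proof.
move=> x; apply: (@continuous2_cvg _ _ _ _ _ _ (fun=> k : K^o) f *:%R k (f x)).
- exact: (@scale_continuous K E (k, f x)).
- exact: cvg_cst.
- exact: cts_fun.
Qed.

Definition cts_scale (k : K) f : continuousType X E := mkcts (@scale_cts k f).

Let scaleA a b f : cts_scale a (cts_scale b f) = cts_scale (a * b) f.
Proof. by apply/continuousEP => x; exact: scalerA. Qed.
Let scale1 : left_id 1 cts_scale.
Proof. by move=> f; apply/continuousEP => x; exact: scale1r. Qed.
Let scaleDr : right_distributive cts_scale +%R.
Proof. by move=> a f g; apply/continuousEP => x; exact: scalerDr. Qed.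
Let scaleDl f : {morph cts_scale^~ f : a b / a + b}.
Proof. by move=> a b; apply/continuousEP => x; exact: scalerDl. Qed.

HB.instance Definition _ := GRing.Zmodule_isLmodule.Build K (continuousType X E)
  scaleA scale1 scaleDr scaleDl.

Lemma ctsZ k f x : (k *: f) x = k *: f x. Proof. by []. Qed.
End continuous_lmodule.

(* The compactness proof is a parameter of the type because the supremum norm
   is a norm only on bounded functions. *)
Definition sup_cts (R : realType) (Y : topologicalType)
  (cptY : compact [set: Y]) : Type := continuousType Y R^o.

Section sup_norm.
Context {R : realType} {Y : topologicalType} (cptY : compact [set: Y]).
Local Notation CY := (sup_cts R cptY).

HB.instance Definition _ := GRing.Lmodule.copy CY (continuousType Y R^o).

Definition sup_norm (f : CY) : R := sup (range (fun y => `|f y|)).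

Let has_ub_range (f : CY) : has_ubound (range (fun y => `|f y|)).
Proof.
have cf : compact (f @` [set: Y]).
  apply: continuous_compact cptY; apply: continuous_subspaceT; exact: cts_fun.
have [M [_ fM]] := compact_bounded cf.
exists (M + 1) => _ [y _ <-]; apply: (fM (M + 1)); last by exists y.
by rewrite ltrDl.
Qed.

Lemma ler_sup_norm (f : CY) y : `|f y| <= sup_norm f.
Proof. by apply: ub_le_sup; [exact: has_ub_range|exists y]. Qed.

Lemma sup_norm_le (f : CY) (M : R) :
  0 <= M -> (forall y, `|f y| <= M) -> sup_norm f <= M.
Proof.
move=> M0 fM; rewrite /sup_norm.
have [->|/set0P ne] := eqVneq (range (fun y => `|f y|)) set0.
  by rewrite sup0.
by apply: ge_sup => // _ [y _ <-].
Qed.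

Lemma sup_norm_ge0 (f : CY) : 0 <= sup_norm f.
Proof.
rewrite /sup_norm.
have [->|/set0P ne] := eqVneq (range (fun y => `|f y|)) set0.
  by rewrite sup0.
by case: ne => _ [y _ _]; apply: le_trans (ler_sup_norm f y).
Qed.

Let sup_normD (f g : CY) : sup_norm (f + g) <= sup_norm f + sup_norm g.
Proof.
apply: sup_norm_le => [|y]; first by rewrite addr_ge0 ?sup_norm_ge0.
by rewrite (le_trans (ler_normD _ _))// lerD ?ler_sup_norm.
Qed.

Let sup_normZ_le (k : R) (f : CY) : sup_norm (k *: f) <= `|k| * sup_norm f.
Proof.
apply: sup_norm_le => [|y]; first by rewrite mulr_ge0 ?sup_norm_ge0.
by rewrite normrM ler_wpM2l ?ler_sup_norm.
Qed.

Let sup_normZ (k : R) (f : CY) : sup_norm (k *: f) = `|k| * sup_norm f.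
Proof.
apply/le_anti; rewrite sup_normZ_le/=.
have [->|k0] := eqVneq k 0; first by rewrite normr0 mul0r sup_norm_ge0.
rewrite -ler_pdivlMl ?normr_gt0// -normfV.
by rewrite -[X in sup_norm X <= _](scalerK k0) sup_normZ_le.
Qed.

Let sup_norm0_eq0 (f : CY) : sup_norm f = 0 -> f = 0.
Proof.
move=> f0; apply/continuousEP => y; apply/eqP.
by rewrite -normr_le0 -f0 ler_sup_norm.
Qed.

HB.instance Definition _ :=
  Lmodule_isNormed.Build R CY sup_normD sup_normZ sup_norm0_eq0.

Lemma sup_ctsE (f : CY) : `|f| = sup (range (fun y => `|f y|)).
Proof. by []. Qed.

Let sup_cts_complete (F : set_system CY) :
  ProperFilter F -> cauchy F -> cvg F.
Proof.
move=> FF /cauchy_ballP Fc.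
pose u (f : CY) : arrow_uniform_type Y R^o := f.
have uc : cauchy (u @ F).
  move=> A [B]; rewrite -entourage_ballE.
  move=> [e /= e0 eB] BA; have [[P Q] /= [FP FQ] PQ] := Fc e e0.
  exists (u @` P, u @` Q).
    by split; [apply: filterS FP|apply: filterS FQ] => f ?; exists f.
  move=> [_ _] [/= [f Pf <-] [g Qg <-]].
  apply: BA => y; apply: eB => /=.
  rewrite -ball_normE/=; apply: le_lt_trans (ler_sup_norm (f - g) y) _.
  by have := PQ (f, g) (conj Pf Qg); rewrite -ball_normE.
have /cvg_ex[/= h uh] : cvg (u @ F) by exact: fun_complete.
have ch : continuous (h : Y -> R^o).
  apply: (@uniform_limit_continuous _ _ (u @ F)).
    by apply: (@filterE _ F) => f; exact: cts_fun.
  by rewrite uniform_nbhsT.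
apply/cvg_ex; exists (mkcts ch : CY).
apply/cvgrPdist_le => e e0.
have /cvg_fct_entourageP/(_ _ (entourage_ball R^o (PosNum e0))) hF := uh.
apply: (@filterS _ F _ _ _ _ hF) => f hf.
apply: sup_norm_le => [|y]; first exact: ltW.
by have := hf y; rewrite /= -ball_normE => /ltW.
Qed.

HB.instance Definition _ := Uniform_isComplete.Build CY sup_cts_complete.
End sup_norm.

Definition Cp (K : numFieldType) (X : topologicalType) (E : tvsType K) : Type :=
  continuousType X E.

Section pointwise_topology.
Context {K : numFieldType} {X : topologicalType} {E : tvsType K}.
Local Notation CpE := (Cp X E).

HB.instance Definition _ := GRing.Lmodule.copy CpE (continuousType X E).
HB.instance Definition _ := Uniform.copy CpE
  (initial_topology (fun f : continuousType X E => (f : {ptws X -> E}))).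

Lemma Cp_cvgP (F : set_system CpE) (f : CpE) : Filter F ->
  F --> f <-> forall x, (g x @[g --> F]) --> f x.
Proof.
move=> FF; rewrite -(@pointwise_cvgP X E ((fun g : CpE => g : X -> E) @ F) f).
split=> [Ff|Ff A].
  apply: cvg_comp Ff _.
  exact: (@initial_continuous _ _ (fun g : CpE => (g : {ptws X -> E}))).
case=> _ [[B oB <-] Bf] BA.
by apply: filterS BA _; apply: Ff; exact: open_nbhs_nbhs.
Qed.

Lemma Cp_eval_continuous (x : X) : continuous (fun f : CpE => f x).
Proof. by move=> f; exact: ((Cp_cvgP (F := nbhs f) f _).1 cvg_id x). Qed.

Let Cp_add_continuous : continuous (fun z : CpE * CpE => z.1 + z.2).
Proof.
move=> [f g]; apply/Cp_cvgP => x.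
apply: (@continuous2_cvg _ _ _ _ _ (nbhs_filter (f, g))
  (fun z : CpE * CpE => z.1 x)
  (fun z : CpE * CpE => z.2 x) +%R (f x) (g x)).
- exact: (@add_continuous E (f x, g x)).
- apply: (@continuous_comp _ _ _ (@fst CpE CpE) (fun h : CpE => h x) (f, g)).
    exact: cvg_fst.
  exact: Cp_eval_continuous.
- apply: (@continuous_comp _ _ _ (@snd CpE CpE) (fun h : CpE => h x) (f, g)).
    exact: cvg_snd.
  exact: Cp_eval_continuous.
Qed.

Let Cp_scale_continuous : continuous (fun z : K^o * CpE => z.1 *: z.2).
Proof.
move=> [k f]; apply/Cp_cvgP => x.
apply: (@continuous2_cvg _ _ _ _ _ (nbhs_filter (k, f))
  (fun z : K^o * CpE => z.1)
  (fun z : K^o * CpE => z.2 x) *:%R k (f x)).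
- exact: (@scale_continuous K E (k, f x)).
- exact: cvg_fst.
- apply: (@continuous_comp _ _ _ (@snd K^o CpE) (fun h : CpE => h x) (k, f)).
    exact: cvg_snd.
  exact: Cp_eval_continuous.
Qed.

Let Cp_locally_convex : exists2 B : set_system CpE,
  (forall b, b \in B -> convex_set b) & basis B.
Proof.
exists [set U : set CpE | open U /\ convex_set U].
  by move=> b; rewrite inE => -[].
split=> [U []//|f].
have FF : Filter (filter_from
    [set U : set CpE | (open U /\ convex_set U) /\ U f] id).
  apply: filter_from_filter.
    exists setT; split=> //; split; first exact: openT.
    by move=> *; rewrite inE.
  move=> U V [[oU cU] Uf] [[oV cV] Vf]; exists (U `&` V) => //.
  split=> //; split; first exact: openI.
  move=> g h l; rewrite !in_setI => /andP[gU gV] /andP[hU hV].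
  by rewrite cU ?cV.
apply/Cp_cvgP => x A Afx.
have [B cB [oB /(_ (f x) A Afx) [b [Bb bfx] bA]]] := @locally_convex K E.
exists ((fun g : CpE => g x) @^-1` b); last by move=> g; exact: bA.
split=> //; split.
  apply: open_comp; last exact: oB.
  by move=> g _; exact: Cp_eval_continuous.
move=> g h l; rewrite !inE => gb hb; apply/set_mem.
by apply: cB; exact/mem_set.
Qed.

HB.instance Definition _ :=
  PreTopologicalNmodule_isTopologicalNmodule.Build CpE Cp_add_continuous.
HB.instance Definition _ :=
  TopologicalNmodule_isTopologicalLmodule.Build K CpE Cp_scale_continuous.
HB.instance Definition _ := Uniform_isTvs.Build K CpE Cp_locally_convex.
End pointwise_topology.

Definition isomorphic (K : numDomainType) (E F : tvsType K) : Prop :=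
  exists (T : {linear E -> F}) (S : F -> E),
    [/\ cancel T S, cancel S T, continuous T & continuous S].
Arguments isomorphic K E F : clear implicits.

(* Main.v *)
Require Import Defs.
From HB Require Import structures.
From mathcomp Require Import all_boot all_order all_algebra.
From mathcomp Require Import all_classical all_reals all_analysis.
From mathcomp Require Import ring lra.

Set Implicit Arguments.
Unset Strict Implicit.
Unset Printing Implicit Defensive.

Import Order.TTheory GRing.Theory Num.Theory.
Import numFieldNormedType.Exports.

Local Open Scope classical_set_scope.
Local Open Scope ring_scope.

(** Write F for the Banach space C(Y) and E for C_p(X, F).  The theorem is a
shift argument.  Suppose E contains functions e_n whose cozero sets are
pairwise disjoint, and carries continuous linear functionals phi_n such that
phi_n(e_n) = 1 and phi_n(h) only depends on the values of h where e_n does not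
vanish.  Suppose moreover that for every h in E the sequence phi_n(h) belongs
to a shift-invariant space A of real sequences such that J(a) = sum_n a_n e_n
is continuous on X for all a in A.  Then h = (h - J(phi(h))) + J(phi(h)), and
shifting the coordinates phi_n(h) one step to the left, while storing phi_0(h)
in the factor R, is an isomorphism of E onto E x R.  Continuity for the
pointwise topologies is automatic: at a given point x at most one e_n is
nonzero, so that evaluating at x involves finitely many functionals
([shift_isomorphic]).

Such a system is found in one of two ways.

If some h in E has a range that is not totally bounded, there are points x_n
whose images are eps-separated.  The cones of radius eps / 4 around h(x_n), in
a fixed direction of F, pull back along h to a locally finite family e_n; A
consists of all sequences and phi_n is a functional evaluated at x_n
([isomorphic_of_separated]).

If all ranges are totally bounded, A is c_0, and J(a) converges uniformly as
soon as the e_n are bounded.  What has to be ensured is phi_n(h) -> 0 for all h.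
Take phi_n to be the average of the 2^N functionals
h |-> N^-1 sum_i s_i h(x_(n,s))(y_i), where N = n + 1, s ranges over the sign
vectors of length N, the points x_(n,s) of X are distinct, and so are the points
y_i of Y.  For a fixed vector w of F the signs are orthogonal, hence the
average over s of |N^-1 sum_i s_i w(y_i)| is at most |w| / sqrt N
([signed_average_cvg0]).  Since the values h(x_(n,s)) are within eps of a finite
set of vectors, the averages phi_n(h) also tend to zero ([null_blocks_cvg0]).
Functions with disjoint cozero sets on X and on Y, which exist because both are
infinite and Tychonoff ([disjoint_bumps]), provide the functions e_n of norm at
most one ([isomorphic_of_totally_bounded], [null_blocks_sup_cts]). *)

(** * Functions with disjoint cozero sets *)

Definition disjoint_cozero {I X : Type} {V : nmodType} (e : I -> X -> V) :=
  forall x m n, e m x != 0 -> e n x != 0 -> m = n.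

Section sum_disjoint.
Context {V : nmodType} {I : finType} (u : I -> V).
Hypothesis du : forall i j, u i != 0 -> u j != 0 -> i = j.

Lemma sum_disjoint_nz i : u i != 0 -> \sum_j u j = u i.
Proof.
move=> ui; rewrite (bigD1 i)//= big1 ?addr0// => j ji; apply/eqP.
by apply: contraNT ji => uj; rewrite (du uj ui).
Qed.

Lemma sum_disjoint : \sum_j u j = 0 \/ exists2 i, u i != 0 & \sum_j u j = u i.
Proof.
have [[i ui]|none] := pselect (exists i, u i != 0).
  by right; exists i => //; exact: sum_disjoint_nz.
left; apply: big1 => i _; apply/eqP; apply: contra_notT none => ui.
by exists i.
Qed.
End sum_disjoint.

(** Given disjoint neighbourhoods P of p and Q of q in V, either the complement
of the closure of P is infinite, or Q is finite, hence closed, and then its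
complement is infinite.  In both cases an infinite open set is left over, so
the construction can go on. *)
Lemma hausdorff_infinite_split (T : topologicalType) (V : set T) :
  hausdorff_space T -> open V -> infinite_set V ->
  exists (x : T) (U V' : set T), [/\ open U, U x & U `<=` V] /\
    [/\ open V', infinite_set V', V' `<=` V & U `&` V' = set0].
Proof.
move=> hT oV infV.
have [p Vp] : V !=set0 by exact: infinite_setN0.
have [q [Vq qp]] : (V `\` [set p]) !=set0.
  by apply: infinite_setN0; apply: infinite_setD => //; exact: finite_set1.
have pq : p != q by apply/eqP => pq; exact: qp.
have := hT; rewrite open_hausdorff => /(_ _ _ pq).
move=> [[P Q] /= [/set_mem Pp /set_mem Qq] [oP oQ /eqP PQ]].
have [infP|/contrapT finP] := pselect (infinite_set (V `\` closure P)).
  exists p, (P `&` V), (V `\` closure P); split; split=> //.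
  - exact: openI.
  - by apply: openI => //; apply: closed_openC; exact: closed_closure.
  - by apply/seteqP; split=> // x [[Px _] [_]]; apply; exact: subset_closure.
have finQ : finite_set (Q `&` V).
  apply: sub_finite_set finP => x [Qx Vx]; split=> // cPx.
  have [y [Py Qy]] := cPx Q (open_nbhs_nbhs (conj oQ Qx)).
  by have : (P `&` Q) y by []; rewrite PQ.
exists q, (Q `&` V), (V `\` (Q `&` V)); split; split=> //.
- exact: openI.
- apply: openI => //; apply: closed_openC.
  by apply: accessible_finite_set_closed.1 finQ; exact: hausdorff_accessible.
- exact: infinite_setD.
- by apply/seteqP; split=> // x [? []].
Qed.

Lemma disjoint_open_sequence (T : topologicalType) :
  hausdorff_space T -> infinite_set [set: T] ->
  exists (x : nat -> T) (U : nat -> set T),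
    [/\ forall n, open (U n), forall n, U n (x n) &
      forall m n z, U m z -> U n z -> m = n].
Proof.
move=> hT infT; have [t0 _] := infinite_setN0 infT.
have /choice[g gP] (V : set T) : exists w : T * set T * set T,
    open V -> infinite_set V -> [/\ open w.1.2, w.1.2 w.1.1 & w.1.2 `<=` V] /\
    [/\ open w.2, infinite_set w.2, w.2 `<=` V & w.1.2 `&` w.2 = set0].
  have [[oV iV]|nV] := pselect (open V /\ infinite_set V).
    have [x [U [V' h]]] := hausdorff_infinite_split hT oV iV.
    by exists (x, U, V').
  by exists (t0, setT, setT) => oV iV; case: nV.
pose W n := iter n (fun V => (g V).2) setT.
have WP n : open (W n) /\ infinite_set (W n).
  elim: n => [|n [oW iW]]; first by split; [exact: openT|].
  by have [_ [? ? _ _]] := gP _ oW iW.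
have gW n := gP _ (WP n).1 (WP n).2.
have subW m n : (m <= n)%N -> W n `<=` W m.
  elim: n => [|n IH]; first by rewrite leqn0 => /eqP ->.
  rewrite leq_eqVlt => /predU1P[->//|/IH Wnm].
  by apply: subset_trans Wnm; have [_ []] := gW n.
exists (fun n => (g (W n)).1.1), (fun n => (g (W n)).1.2); split.
- by move=> n; have [[]] := gW n.
- by move=> n; have [[]] := gW n.
have lt_disj m n z : (m < n)%N -> (g (W m)).1.2 z -> (g (W n)).1.2 z -> False.
  move=> mn Umz Unz; have [_ [_ _ _ disj]] := gW m.
  suff : ((g (W m)).1.2 `&` (g (W m)).2) z by rewrite disj.
  split=> //; apply: (subW _ _ mn); have [[_ _ UW] _] := gW n; exact: UW.
move=> m n z Um Un; case: (ltngtP m n) => // mn.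
  by case: (lt_disj _ _ _ mn Um Un).
by case: (lt_disj _ _ _ mn Un Um).
Qed.

Lemma disjoint_bumps (R : realType) (T : topologicalType) :
  tychonoff_space T -> infinite_set [set: T] ->
  exists (x : nat -> T) (f : nat -> T -> R),
    [/\ forall n, continuous (f n), forall n z, `|f n z| <= 1,
        forall n, f n (x n) = 1 &
        disjoint_cozero f].
Proof.
move=> [crT hT] infT; have [x [U [oU Ux dU]]] := disjoint_open_sequence hT infT.
have /choice[f fP] n : exists f : T -> R, [/\ continuous f,
    forall z, `|f z| <= 1, f (x n) = 1 & forall z, f z != 0 -> U n z].
  have /(@uniform_separatorP T R)[g [cg g01 g0 g1]] :
    uniform_separator [set x n] (~` U n).
    by apply: crT; [exact: open_closedC|apply; exact: Ux].
  exists (fun z => 1 - g z); split.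
  - by move=> z; apply: cvgB; [exact: cvg_cst|exact: cg].
  - move=> z; have /g01 /= : range g (g z) by exists z.
    by rewrite in_itv /= ler_norml => /andP[? ?]; apply/andP; split; lra.
  - by rewrite (g0 (g (x n))) ?subr0//; exists (x n).
  - move=> z; apply: contra_neqP => nUz.
    by rewrite (g1 (g z)) ?subrr//; exists z.
exists x, f; split=> [n|n|n|].
- by have [] := fP n.
- by have [] := fP n.
- by have [] := fP n.
- move=> z m n fm fn; apply: (dU m n z); first by have [_ _ _] := fP m; apply.
  by have [_ _ _] := fP n; apply.
Qed.

(** * Continuous linear functionals *)

Section functionals.
Context {R : realType} {F : normedModType R}.

Lemma functionalD (p : F -> R) : linear (p : F -> R^o) ->
  {morph p : u v / u + v}.
Proof. by move=> lp u v; have := lp 1 u v; rewrite !scale1r. Qed.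

Lemma functional0 (p : F -> R) : linear (p : F -> R^o) -> p 0 = 0.
Proof.
by move=> lp; apply: (addrI (p 0)); rewrite -functionalD// !addr0.
Qed.

Lemma functionalB (p : F -> R) : linear (p : F -> R^o) ->
  {morph p : u v / u - v}.
Proof.
by move=> lp u v; apply: (addIr (p v)); rewrite -functionalD// !subrK.
Qed.

Lemma functional_continuous (p : F -> R) : linear (p : F -> R^o) ->
  (forall v, `|p v| <= `|v|) -> continuous p.
Proof.
move=> lp bp v; apply/cvgrPdist_le => eps eps0.
have /cvgrPdist_le/(_ _ eps0) := @cvg_id _ (nbhs v).
apply: filterS => w vw.
by rewrite -(functionalB lp) (le_trans (bp _)).
Qed.
End functionals.

(** The evaluation map is continuous for every locally convex space; stating it
for a normed space fixes the path along which the topology of F is inferred. *)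
Lemma eval_continuous (R : realType) (X : topologicalType)
  (F : normedModType R) (x : X) : continuous (fun h : Cp X F => h x : F).
Proof. exact (@Cp_eval_continuous R X F x). Qed.

Lemma cts_to_Cp (R : realType) (Z X : topologicalType) (F : normedModType R)
  (T : Z -> Cp X F) : (forall x, continuous (fun z => T z x)) -> continuous T.
Proof. by move=> cT z; apply/(@Cp_cvgP R X F (T @ nbhs z)) => x; exact: cT. Qed.

Lemma functional_eval_continuous (R : realType) (X : topologicalType)
  (F : normedModType R) (p : F -> R) x : linear (p : F -> R^o) ->
  (forall v, `|p v| <= `|v|) -> continuous (fun h : Cp X F => p (h x)).
Proof.
move=> lp bp h; apply: (@continuous_comp _ _ _ (fun h : Cp X F => h x : F) p h).
  exact: eval_continuous.
exact: functional_continuous.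
Qed.

(** * Infinite sums of functions with disjoint cozero sets *)

Section disjoint_sums.
Context {R : realType} {X : topologicalType} {F : normedModType R}.
Implicit Types (e : nat -> X -> F) (a b : nat -> R).

(** The sum of the series of the a_n e_n.  When the e_n have disjoint cozero
sets at most one term is nonzero at x, so picking that term replaces the limit;
the default index 0 is reached only where all e_n vanish. *)
Definition dsum e a x : F :=
  let n := xget 0%N [set n | e n x != 0] in a n *: e n x.

Lemma dsumE e a n x : disjoint_cozero e -> e n x != 0 ->
  dsum e a x = a n *: e n x.
Proof.
move=> de enx; rewrite /dsum; case: xgetP => [m _ /= emx|/(_ n)]; last by [].
by rewrite (de _ _ _ emx enx).
Qed.

Lemma dsum_eq0 e a x : (forall n, e n x = 0) -> dsum e a x = 0.
Proof. by move=> e0; rewrite /dsum e0 scaler0. Qed.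

Lemma dsumB e a b x : dsum e (fun n => a n - b n) x = dsum e a x - dsum e b x.
Proof. by rewrite /dsum scalerBl. Qed.

(** A local Cauchy criterion: near x the sum differs from a finite partial sum
by at most eps, because the tail has at most one nonzero term.  It covers both
a_n tending to zero with bounded e_n, and locally finite families. *)
Lemma dsum_continuous e a : disjoint_cozero e -> (forall n, continuous (e n)) ->
  (forall (x : X) (eps : R), 0 < eps -> exists N, \forall z \near x,
     forall n, (N <= n)%N -> `|a n *: e n z| <= eps) ->
  continuous (dsum e a).
Proof.
move=> de ce tl x; apply/cvgrPdist_le => eps eps0.
have e30 : 0 < eps / 3 by rewrite divr_gt0.
have [N hN] := tl x _ e30.
pose q z := \sum_(n < N) a n *: e n z.
have cq : continuous q.
  move=> z; apply: cvg_big => [|n _]; first exact: add_continuous.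
  by apply: cvgZ; [exact: cvg_cst|exact: ce].
have close z : (forall n, (N <= n)%N -> `|a n *: e n z| <= eps / 3) ->
    `|dsum e a z - q z| <= eps / 3.
  move=> zN; have [[n enz]|e0] := pselect (exists n, e n z != 0); last first.
    have {}e0 n : e n z = 0.
      by apply/eqP/negPn/negP => nz; apply: e0; exists n.
    rewrite dsum_eq0// /q big1 ?subrr ?normr0 ?ltW// => i _.
    by rewrite e0 scaler0.
  rewrite (dsumE _ de enz).
  have z0 m : m != n -> a m *: e m z = 0.
    move=> mn; have -> : e m z = 0; last by rewrite scaler0.
    by apply/eqP; apply: contraNT mn => emz; apply/eqP; exact: de enz.
  have [nN|Nn] := ltnP n N.
    rewrite /q (bigD1 (Ordinal nN))//= big1 ?addr0 ?subrr ?normr0 ?ltW//.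
    by move=> i ni; rewrite z0.
  rewrite /q big1 ?subr0; first exact: zN.
  by move=> i _; rewrite z0// neq_ltn (leq_trans (ltn_ord i) Nn).
have := cq x => /cvgrPdist_le/(_ _ e30) qx.
near=> z.
have -> : dsum e a x - dsum e a z =
    (dsum e a x - q x) + (q x - q z) - (dsum e a z - q z).
  by rewrite addrA subrK opprB addrA subrK.
rewrite (le_trans (ler_normB _ _))//.
have -> : eps = eps / 3 + eps / 3 + eps / 3 by lra.
apply: lerD.
  rewrite (le_trans (ler_normD _ _))// lerD//.
    by apply: close => n; apply: (nbhs_singleton hN).
  by near: z.
by apply: close; near: z.
Unshelve. all: by end_near. Qed.

End disjoint_sums.

(** * The shift isomorphism *)

(** With J(a) the sum of the a_n e_n, the map
h |-> (h - J(phi(h)) + J(left shift of phi(h)), phi_0(h)) has the inverse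
(h, r) |-> h - J(phi(h)) + J(r, phi_0(h), phi_1(h), ...).  Both only add
multiples of e_n with n determined by the point of evaluation, hence are
continuous for the pointwise topologies even though the family of all phi_n
need not be equicontinuous.  The last hypothesis says that phi_n is
carried by the cozero set of e_n; as J(a) agrees there with a_n e_n, it gives
phi_n(J(a)) = a_n. *)
Lemma shift_isomorphic (R : realType) (X : topologicalType)
    (F : normedModType R) (A : set (nat -> R))
    (e : nat -> Cp X F) (phi : nat -> Cp X F -> R) :
  (forall a b, A a -> A b -> A (fun n => a n - b n)) ->
  (forall a, A a -> A (fun n => a n.+1)) ->
  (forall a r, A a -> A (fun n => if n is m.+1 then a m else r)) ->
  disjoint_cozero (fun n => e n : X -> F) ->
  (forall a, A a -> continuous (dsum (fun n => e n : X -> F) a)) ->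
  (forall n, linear (phi n : Cp X F -> R^o)) ->
  (forall n, continuous (phi n : Cp X F -> R^o)) ->
  (forall h, A (phi ^~ h)) ->
  (forall n, phi n (e n) = 1) ->
  (forall n (h : Cp X F), (forall x, e n x != 0 -> h x = 0) -> phi n h = 0) ->
  isomorphic R (Cp X F) (Cp X F * R^o)%type.
Proof.
move=> AB Atl Acons de cJ lphi cphi Aphi phie phi0.
pose J a : Cp X F := if pselect (A a) is left Aa then mkcts (cJ a Aa) else 0.
have JE a : A a -> forall x, J a x = dsum (fun n => e n : X -> F) a x.
  by move=> Aa x; rewrite /J; case: pselect.
have phiP n k f g : phi n (k *: f + g) = k * phi n f + phi n g by exact: lphi.
have phiD n f g : phi n (f + g) = phi n f + phi n g.
  by rewrite -[f]scale1r phiP mul1r scale1r.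
have phiJ a n : A a -> phi n (J a) = a n.
  move=> Aa; have -> : J a = a n *: e n + (J a - a n *: e n).
    by rewrite addrC subrK.
  rewrite phiP phie mulr1 phi0 ?addr0// => x enx.
  by rewrite ctsD ctsN ctsZ JE// (dsumE _ de enx) subrr.
have JB a b : A a -> A b -> J (fun n => a n - b n) = J a - J b.
  move=> Aa Ab; apply/continuousEP => x.
  by rewrite ctsD ctsN !JE ?dsumB//; exact: AB.
pose tl (a : nat -> R) n := a n.+1.
pose cons (r : R) (a : nat -> R) n := if n is m.+1 then a m else r.
pose T (h : Cp X F) : Cp X F * R^o :=
  (h + J (fun n => tl (phi^~ h) n - phi n h), phi 0%N h).
pose S (u : Cp X F * R^o) : Cp X F :=
  u.1 + J (fun n => cons u.2 (phi^~ u.1) n - phi n u.1).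
have AT h : A (fun n => tl (phi^~ h) n - phi n h).
  by apply: AB => //; exact: Atl.
have AS u : A (fun n => cons u.2 (phi^~ u.1) n - phi n u.1).
  by apply: AB => //; exact: Acons.
have linT : linear T.
  move=> k f g; rewrite /T; congr pair; last exact: phiP.
  apply/continuousEP => x; rewrite !(ctsD, ctsZ) !JE// /dsum.
  rewrite scalerDr addrACA; congr (_ + _).
  rewrite scalerA -scalerDl /tl !phiP; congr (_ *: _).
  by rewrite opprD addrACA mulrBr.
have phiT h n : phi n (T h).1 = phi n.+1 h.
  by rewrite /T/= phiD phiJ// /tl addrC subrK.
have phiS u n : phi n (S u) = cons u.2 (phi^~ u.1) n.
  by rewrite /S/= phiD phiJ// addrC subrK.
pose lT := GRing.isLinear.Build _ _ _ _ T linT.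
pose Tl : {linear Cp X F -> (Cp X F * R^o)%type} := HB.pack T lT.
exists Tl, S; split.
- move=> h; change (S (T h) = h).
  have Ap := Aphi h.
  have -> : S (T h) = (T h).1 + J (fun n => phi n h - tl (phi^~ h) n).
    rewrite /S; congr (_ + J _); apply/funext => n.
    by rewrite phiT; case: n => [//|n]; rewrite /= phiT.
  have At := Atl _ Ap.
  rewrite /T/= (JB (tl (phi^~ h)) (phi^~ h))// (JB (phi^~ h) (tl (phi^~ h)))//.
  by rewrite -addrA -[X in _ + (_ + X)]opprB subrr addr0.
- move=> u; change (T (S u) = u).
  rewrite /T.
  have -> : (fun n => tl (phi^~ (S u)) n - phi n (S u)) =
      (fun n => phi n u.1 - cons u.2 (phi^~ u.1) n).
    by apply/funext => n; rewrite /tl !phiS.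
  rewrite phiS [RHS]surjective_pairing; congr pair.
  have Ap := Aphi u.1; have Ac := Acons _ u.2 Ap.
  rewrite /S (JB (phi^~ u.1) (cons u.2 (phi^~ u.1)))//.
  rewrite (JB (cons u.2 (phi^~ u.1)) (phi^~ u.1))//.
  by rewrite -addrA -[X in _ + (_ + X)]opprB subrr addr0.
- pose nu x := xget 0%N [set n | e n x != 0].
  have TE x : (fun h => (T h).1 x) =
      (fun h => h x + (phi (nu x).+1 h - phi (nu x) h) *: e (nu x) x).
    by apply/funext => h; rewrite ctsD JE.
  have cT x : continuous (fun h : Cp X F => (T h).1 x : F).
    rewrite TE => h.
    have ev : (fun g : Cp X F => g x) g @[g --> h] --> h x.
      exact: eval_continuous.
    apply: (cvgD ev).
    apply: cvgZ; last exact: cvg_cst.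
    by apply: cvgB; exact: cphi.
  have cT1 : continuous (fun h : Cp X F => (T h).1) by exact: cts_to_Cp.
  move=> h.
  exact: (cvg_pair (cT1 h : (T g).1 @[g --> h] --> nbhs (T h).1)
    (cphi 0%N h : (phi 0%N g : R^o) @[g --> h] --> nbhs (phi 0%N h : R^o))).
- pose nu x := xget 0%N [set n | e n x != 0].
  have SE x : (fun u => S u x) = (fun u => u.1 x +
      (cons u.2 (phi^~ u.1) (nu x) - phi (nu x) u.1) *: e (nu x) x).
    by apply/funext => u; rewrite ctsD JE.
  apply: cts_to_Cp => x; rewrite SE => u.
  have comp1 (V : topologicalType) (f : Cp X F -> V) :
      continuous f -> f z.1 @[z --> u] --> f u.1.
    move=> cf; apply: (@continuous_comp _ _ _ (@fst (Cp X F) R^o) f u).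
      exact: cvg_fst.
    exact: cf.
  apply: (cvgD (comp1 F _ (@eval_continuous _ _ _ x))).
  apply: cvgZ; last exact: cvg_cst.
  apply: cvgB; last exact: (comp1 R^o).
  case: (nu x) => [|n] /=; first exact: cvg_snd.
  exact: (comp1 R^o).
Qed.

(** * Ranges that are not totally bounded *)

Definition totally_bounded_range (R : realType) (X : Type)
    (F : normedModType R) (h : X -> F) :=
  forall eps : R, 0 < eps ->
  exists s : seq F, forall x, exists2 k, k \in s & `|h x - k| < eps.

(** For a suitable eps every finite set of vectors leaves out a value of h at
distance at least eps; choosing such values repeatedly gives the sequence. *)
Lemma not_totally_bounded_separated (R : realType) (X : Type)
    (F : normedModType R) (h : X -> F) : ~ totally_bounded_range h ->
  exists eps : R, exists x : nat -> X, 0 < eps /\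
    forall m n, m != n -> eps <= `|h (x m) - h (x n)|.
Proof.
move=> /existsNP[eps /not_implyP[eps0 /forallNP hs]]; exists eps.
have /choice[g gP] (s : seq F) :
    exists x, forall k, k \in s -> eps <= `|h x - k|.
  have /existsNP[x /forall2NP hx] := hs s; exists x => k ks.
  by have [|/negP] := hx k; [|rewrite -leNgt].
(* L n lists the values at the points chosen before step n. *)
pose L := fix L n := if n is m.+1 then h (g (L m)) :: L m else [::].
exists (fun n => g (L n)); split=> //.
have LP m n : (m < n)%N -> h (g (L m)) \in L n.
  elim: n => // n IH; rewrite ltnS leq_eqVlt inE => /predU1P[->|/IH ->].
    by rewrite eqxx.
  by rewrite orbT.
move=> m n; rewrite neq_ltn => /orP[|] /LP mn; last exact: gP.
by rewrite distrC; exact: gP.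
Qed.

(** The functions e_n are bumps of radius eps / 4 around h(x_n), composed with
h and multiplied by v.  The ball of radius eps / 4 around any h(z) meets at most
one of them, so every series of the a_n e_n is locally a finite sum, and the
shift applies with all real sequences. *)
Lemma isomorphic_of_separated (R : realType) (X : topologicalType)
    (F : normedModType R) (v : F) (p : F -> R) (h : Cp X F) (eps : R)
    (x : nat -> X) :
  linear (p : F -> R^o) -> (forall u, `|p u| <= `|u|) -> p v = 1 ->
  0 < eps -> (forall m n, m != n -> eps <= `|h (x m) - h (x n)|) ->
  isomorphic R (Cp X F) (Cp X F * R^o)%type.
Proof.
move=> lp bp pv eps0 sepx.
pose t n z := 1 - 4 / eps * `|h z - h (x n)|.
(* This is the positive part of t. *)
pose b n z := (t n z + `|t n z|) / 2.
have cb n : continuous (b n).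
  move=> z; apply: cvgM; last exact: cvg_cst.
  suff ct : t n w @[w --> z] --> t n z by apply: (cvgD ct); exact: cvg_norm.
  apply: cvgB; first exact: cvg_cst.
  apply: cvgM; first exact: cvg_cst.
  apply: cvg_norm; apply: cvgB; last exact: cvg_cst.
  exact: cts_fun.
have ce n : continuous (fun z => b n z *: v).
  by move=> z; apply: cvgZ; [exact: cb|exact: cvg_cst].
pose e n : Cp X F := mkcts (ce n).
have near_center n z : e n z != 0 -> `|h z - h (x n)| < eps / 4.
  apply: contraNT; rewrite -leNgt => far.
  suff t0 : t n z <= 0.
    by rewrite /e/= /mkcts /b ler0_norm// subrr mul0r scale0r.
  rewrite subr_le0.
  rewrite (le_trans _ (ler_wpM2l _ far)) ?divr_ge0 ?(ltW eps0)//.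
  by rewrite mulrA divfK ?divff ?gt_eqF.
have uniq (z : X) m n : `|h z - h (x m)| < eps / 2 ->
    `|h z - h (x n)| < eps / 2 -> m = n.
  move=> zm zn; apply/eqP; apply: contraT => /sepx.
  rewrite leNgt => /negP; case.
  rewrite (le_lt_trans (ler_distD (h z) _ _))// [X in X + _]distrC.
  by have := ltrD zm zn; rewrite -splitr.
have ex n : e n (x n) = v.
  rewrite /e/= /mkcts /b /t subrr normr0 mulr0 subr0 normr1.
  by rewrite divff// scale1r.
have p0 := functional0 lp.
have v0 : v != 0.
  by apply/eqP => v0; move: (oner_neq0 R); rewrite -pv v0 p0 eqxx.
have nz4 : eps / 4 < eps / 2 by lra.
apply: (@shift_isomorphic R X F setT e (fun n g => p (g (x n)))) => //.
- by move=> z m n /near_center zm /near_center zn; apply: (uniq z); lra.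
- move=> a _; apply: dsum_continuous.
  + by move=> z m n /near_center zm /near_center zn; apply: (uniq z); lra.
  + by move=> n; exact: ce.
  move=> z d d0.
  have near_z : \forall w \near z, `|h z - h w| < eps / 4.
    have e40 : 0 < eps / 4 by lra.
    by have /cvgrPdist_lt/(_ _ e40) := @cts_fun _ _ h z.
  have close w n : `|h z - h w| < eps / 4 -> e n w != 0 ->
      `|h z - h (x n)| < eps / 2.
    move=> zw /near_center wn; rewrite (le_lt_trans (ler_distD (h w) _ _))//.
    by lra.
  have [[n zn]|none] := pselect (exists n, `|h z - h (x n)| < eps / 2).
    exists n.+1; apply: filterS near_z => w zw m nm.
    rewrite (_ : e m w = 0) ?scaler0 ?normr0 ?ltW//.
    apply/eqP; apply: contraTT nm => /(close _ _ zw) zm.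
    by rewrite (uniq _ _ _ zm zn) ltnn.
  exists 0%N; apply: filterS near_z => w zw m _.
  rewrite (_ : e m w = 0) ?scaler0 ?normr0 ?ltW//.
  by apply/eqP; apply: contra_notT none => /(close _ _ zw); exists m.
- by move=> n k f g; exact: lp.
- by move=> n; exact: functional_eval_continuous.
- by move=> n; rewrite ex.
- by move=> n g g0; rewrite (g0 (x n)) ?ex.
Qed.

(** * Totally bounded ranges *)

(** Finite blocks of functionals in the unit ball of the dual, each attaining
its norm at a unit vector v n s, such that the block averages of |p n s| tend
to zero pointwise.  With one functional per block this is a normalized
weak-star null sequence, as in the Josefson-Nissenzweig theorem; allowing
averages makes such a system easy to write down in C(Y). *)
Definition null_blocks (R : realType) (F : normedModType R) (S : nat -> finType)
    (p : forall n, S n -> F -> R) (v : forall n, S n -> F) :=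
  [/\ forall n, (0 < #|S n|)%N,
      forall n s, linear (p n s : F -> R^o) /\ (forall w, `|p n s w| <= `|w|),
      forall n s, `|v n s| <= 1 /\ p n s (v n s) = 1 &
      forall w, #|S n|%:R^-1 * \sum_s `|p n s w| @[n --> \oo] --> (0:R)].

(** The block averages of |p n s| tend to zero uniformly on finite sets.  All
functionals are 1-Lipschitz, so total boundedness of the range lets the vector
h (x n s) vary freely with n and s. *)
Lemma null_blocks_cvg0 (R : realType) (F : normedModType R) (S : nat -> finType)
    (p : forall n, S n -> F -> R) (v : forall n, S n -> F) (X : Type)
    (h : X -> F) (x : forall n, S n -> X) :
  null_blocks p v -> totally_bounded_range h ->
  #|S n|%:R^-1 * \sum_s p n s (h (x n s)) @[n --> \oo] --> (0:R).
Proof.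
move=> [S0 lbp _ p0] tb; apply/cvgr0Pnorm_le => eps eps0.
have e20 : 0 < eps / 2 by lra.
have [l lP] := tb _ e20.
pose th n := \sum_(k <- l) #|S n|%:R^-1 * \sum_s `|p n s k|.
have th0 : th @ \oo --> (0 : R).
  have -> : 0 = \sum_(k <- l) (0 : R) by rewrite big1.
  rewrite /th; apply: cvg_big => [|k _]; last exact: p0.
  exact: (@add_continuous R^o).
have /cvgr0Pnorm_le/(_ _ e20) th_near := th0.
apply: filterS th_near => n thn.
have c0 : 0 < #|S n|%:R :> R by rewrite ltr0n.
have bound s : `|p n s (h (x n s))| <= eps / 2 + \sum_(k <- l) `|p n s k|.
  have [k kl hk] := lP (x n s); have [lp bp] := lbp n s.
  rewrite -[h _](subrK k) (functionalD lp) (le_trans (ler_normD _ _))// lerD//.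
    by rewrite (le_trans (bp _))// ltW.
  by rewrite (big_rem k)//= lerDl sumr_ge0.
rewrite normrM normfV (gtr0_norm c0) ler_pdivrMl//.
rewrite (le_trans (ler_norm_sum _ _ _))//.
rewrite (le_trans (ler_sum _ (fun s _ => bound s)))// big_split/=.
rewrite sumr_const exchange_big/= -[_ *+ #|_|]mulr_natl.
have -> : \sum_(k <- l) \sum_s `|p n s k| = #|S n|%:R * th n.
  rewrite /th mulr_sumr; apply: eq_bigr => k _.
  by rewrite mulrA mulfV ?mul1r ?gt_eqF.
rewrite -mulrDr ler_pM2l//.
by have := ler_norm (th n); lra.
Qed.

(** Each functional p n s is evaluated at its own point of X, so that the
function e_n, the sum over s of a bump at that point times v n s, has norm at
most one although the block may be large.  The averages phi_n over the blocks
then send every h to a null sequence, and the shift applies with c_0. *)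
Lemma isomorphic_of_totally_bounded (R : realType) (X : topologicalType)
    (F : normedModType R) (S : nat -> finType)
    (p : forall n, S n -> F -> R) (v : forall n, S n -> F)
    (x : nat -> X) (f : nat -> X -> R) :
  null_blocks p v ->
  (forall n, continuous (f n)) -> (forall n z, `|f n z| <= 1) ->
  (forall n, f n (x n) = 1) -> disjoint_cozero f ->
  (forall h : Cp X F, totally_bounded_range (h : X -> F)) ->
  isomorphic R (Cp X F) (Cp X F * R^o)%type.
Proof.
move=> np cf bf fx df tb; have [S0 lbp vP _] := np.
(* The pairs (n, s) are numbered, to index them by the given bumps. *)
pose k n (s : S n) := pickle (existT (fun n => S n : Type) n s).
have kn n m (s : S n) (t : S m) : k n s = k m t -> n = m.
  by move=> /(pcan_inj pickleK) /(congr1 tag).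
have ks n (s t : S n) : k n s = k n t -> s = t.
  by move=> /(pcan_inj pickleK) /eqP; rewrite eq_Tagged => /eqP.
pose E n z := \sum_s f (k n s) z *: v n s.
have v0 n s : v n s != 0.
  have [lp _] := lbp n s.
  apply/eqP => v0; move: (oner_neq0 R).
  by rewrite -(vP n s).2 v0 (functional0 lp) eqxx.
have uz n z s : (f (k n s) z *: v n s != 0) = (f (k n s) z != 0).
  by rewrite scaler_eq0 negb_or v0 andbT.
have dE n z (s t : S n) : f (k n s) z *: v n s != 0 ->
    f (k n t) z *: v n t != 0 -> s = t.
  by rewrite !uz => fs ft; apply: ks; exact: df fs ft.
have EN n z : `|E n z| <= 1.
  rewrite /E; case: (sum_disjoint (dE n z)) => [->|[s _ ->]].
    by rewrite normr0.
  by rewrite normrZ mulr_ile1//; exact: (vP n s).1.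
have Enz n z : E n z != 0 -> exists s, f (k n s) z != 0.
  rewrite /E; case: (sum_disjoint (dE n z)) => [->|[s + _ _]].
    by rewrite eqxx.
  by rewrite uz; exists s.
have Ex n s : E n (x (k n s)) = v n s.
  by rewrite /E (sum_disjoint_nz (dE n _) (i := s)) ?fx ?scale1r.
have cE n : continuous (E n).
  move=> z; apply: cvg_big => [|s _]; first exact: add_continuous.
  by apply: cvgZ; [exact: cf|exact: cvg_cst].
have disjE : disjoint_cozero E.
  by move=> z m n /Enz[s fs] /Enz[t ft]; apply: kn; exact: df fs ft.
pose e n : Cp X F := mkcts (cE n).
pose phi n (h : Cp X F) := #|S n|%:R^-1 * \sum_s p n s (h (x (k n s))).
apply: (@shift_isomorphic R X F [set a | a @ \oo --> (0 : R)] e phi) => //.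
- by move=> a b /= a0 b0; rewrite -(subr0 0); exact: cvgB.
- by move=> a /= a0; rewrite cvg_shiftS.
- by move=> a r /= a0; rewrite -cvg_shiftS.
- move=> a /= a0; apply: dsum_continuous => // z d d0.
  have /cvgr0Pnorm_le/(_ _ d0)[N _ NP] := a0.
  exists N; apply: nearW => w n nN; rewrite normrZ.
  by rewrite (le_trans _ (NP n nN))// ler_piMr//; exact: EN.
- move=> n c g h; rewrite /phi.
  transitivity (#|S n|%:R^-1 * (c * (\sum_s p n s (g (x (k n s)))) +
      \sum_s p n s (h (x (k n s)))) : R); last by rewrite mulrDr mulrCA.
  congr (_ * _); rewrite mulr_sumr -big_split/=; apply: eq_bigr => s _.
  by have [lp _] := lbp n s; exact: lp.
- move=> n h.
  have cs : \sum_s p n s (g (x (k n s))) @[g --> h] -->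
      (\sum_s p n s (h (x (k n s))) : R^o).
    apply: cvg_big => [|s _]; first exact: (@add_continuous R^o).
    by have [lp bp] := lbp n s; exact: functional_eval_continuous.
  exact: (cvgM (cvg_cst _) cs).
- by move=> h; exact: null_blocks_cvg0 np (tb h).
- move=> n; rewrite /phi.
  rewrite (eq_bigr (fun=> 1)) => [|s _]; last by rewrite [e n _]Ex (vP n s).2.
  by rewrite sumr_const mulVf// pnatr_eq0 -lt0n.
- move=> n h h0; rewrite /phi big1 ?mulr0// => s _; rewrite h0.
    by have [lp _] := lbp n s; exact: functional0.
  by rewrite [e n _]Ex.
Qed.

(** * Averages over sign vectors *)

(** Flipping the i-th sign is an involution which negates every term. *)
Lemma sign_orthogonal (R : realType) (m : nat) (i j : 'I_m) : i != j ->
  \sum_(s : {ffun 'I_m -> bool}) (-1) ^+ s i * (-1) ^+ s j = 0 :> R.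
Proof.
move=> ij; set Z := LHS.
pose flip (s : {ffun 'I_m -> bool}) := [ffun l => (l == i) (+) s l].
have flipK : involutive flip.
  by move=> s; apply/ffunP => l; rewrite !ffunE addbA addbb.
suff : Z = - Z by lra.
rewrite {1}/Z (reindex_inj (inv_inj flipK)) -sumrN; apply: eq_bigr => s _.
by rewrite !ffunE eqxx eq_sym (negPf ij) addTb addFb signrN mulNr.
Qed.

Lemma sum_sqr_signed (R : realType) (m : nat) (w : 'I_m -> R) :
  \sum_(s : {ffun 'I_m -> bool}) (\sum_i (-1) ^+ s i * w i) ^+ 2 =
  #|{ffun 'I_m -> bool}|%:R * \sum_i w i ^+ 2.
Proof.
under eq_bigr => s _.
  rewrite expr2 big_distrlr/=.
  under eq_bigr => i _ do under eq_bigr => j _ do rewrite mulrACA.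
  over.
rewrite exchange_big mulr_sumr; apply: eq_bigr => i _.
rewrite exchange_big (bigD1 i)//= [X in _ + X]big1 ?addr0; last first.
  by move=> j ji; rewrite -mulr_suml sign_orthogonal ?mul0r// eq_sym.
under eq_bigr do rewrite -expr2 sqrr_sign mul1r.
by rewrite sumr_const mulr_natl expr2.
Qed.

(** A form of the inequality of arithmetic and geometric means, which reduces
averages of |u| to averages of u ^ 2 without square roots. *)
Lemma norm_le_square (R : realType) (u eps : R) : 0 < eps ->
  `|u| <= eps / 2 + (2 * eps)^-1 * u ^+ 2.
Proof.
move=> eps0; rewrite -subr_ge0.
have -> : eps / 2 + (2 * eps)^-1 * u ^+ 2 - `|u| =
    (2 * eps)^-1 * (eps - `|u|) ^+ 2.
  by rewrite -(real_normK (num_real u)); field; rewrite gt_eqF.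
by rewrite mulr_ge0 ?sqr_ge0// invr_ge0; lra.
Qed.

(** By orthogonality the mean square over s of N^-1 sum_i s_i w_i is
N^-2 sum_i w_i ^ 2, which is at most M ^ 2 / N. *)
Lemma signed_average_cvg0 (R : realType) (w : nat -> R) (M : R) :
  (forall n, `|w n| <= M) ->
  #|{ffun 'I_n.+1 -> bool}|%:R^-1 * \sum_(s : {ffun 'I_n.+1 -> bool})
     `|n.+1%:R^-1 * \sum_i (-1) ^+ s i * w i| @[n --> \oo] --> (0 : R).
Proof.
move=> wM; apply/cvgr0Pnorm_le => eps eps0.
have M0 : 0 <= M by exact: le_trans (wM 0%N).
near=> n.
set c := #|_|; set N : R := n.+1%:R.
have N0 : 0 < N by rewrite ltr0n.
have c0 : 0 < c%:R :> R.
  by rewrite ltr0n; apply/card_gt0P; exists [ffun=> false].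
have NM : M ^+ 2 <= eps ^+ 2 * N.
  rewrite mulrC -ler_pdivrMr ?exprn_gt0//.
  have : M ^+ 2 / eps ^+ 2 <= n%:R by near: n; exact: nbhs_infty_ger.
  by move=> /le_trans; apply; rewrite ler_nat.
rewrite ger0_norm; last by rewrite mulr_ge0 ?invr_ge0 ?(ltW c0) ?sumr_ge0.
rewrite ler_pdivrMl//.
rewrite (le_trans (ler_sum _ (fun s _ => norm_le_square _ eps0)))// big_split/=.
rewrite sumr_const -[_ *+ #|_|]mulr_natl -mulr_sumr.
under eq_bigr do rewrite exprMn.
rewrite -mulr_sumr sum_sqr_signed -/c.
have sqM : \sum_(i < n.+1) w i ^+ 2 <= N * M ^+ 2.
  rewrite /N -[n.+1 in X in _ <= X]card_ord mulr_natl -sumr_const.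
  apply: ler_sum => i _.
  by rewrite -real_normK ?num_real// lerXn2r ?nnegrE.
have -> : c%:R * eps = c%:R * (eps / 2) + c%:R * (eps / 2) :> R.
  by rewrite -mulrDr -splitr.
rewrite lerD2l.
have q : N^-1 ^+ 2 * (\sum_(i < n.+1) w i ^+ 2) <= eps ^+ 2.
  rewrite exprVn ler_pdivrMl ?exprn_gt0// (le_trans sqM)//.
  by rewrite [N ^+ 2]expr2 -mulrA ler_pM2l// mulrC.
rewrite [N^-1 ^+ 2 * _]mulrCA [(2 * eps)^-1 * _]mulrCA ler_pM2l//.
rewrite ler_pdivrMl ?mulr_gt0//.
by rewrite (le_trans q)// [2 * eps]mulrC mulrACA divff// mulr1 expr2.
Unshelve. all: end_near. Qed.

(** The functionals are the signed averages of the point evaluations at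
y_0, ..., y_n; the same signed sum of the bumps has norm one, because the bumps
are disjoint, and takes the value s_i at y_i. *)
Lemma null_blocks_sup_cts (R : realType) (Y : topologicalType)
    (cptY : compact [set: Y]) (y : nat -> Y) (g : nat -> Y -> R) :
  (forall n, continuous (g n)) -> (forall n z, `|g n z| <= 1) ->
  (forall n, g n (y n) = 1) -> disjoint_cozero g ->
  exists (p : forall n, {ffun 'I_n.+1 -> bool} -> sup_cts R cptY -> R)
    (v : forall n, {ffun 'I_n.+1 -> bool} -> sup_cts R cptY),
    null_blocks p v.
Proof.
move=> cg bg gy dg.
pose p n (s : {ffun 'I_n.+1 -> bool}) (w : sup_cts R cptY) : R :=
  n.+1%:R^-1 * \sum_i (-1) ^+ s i * w (y i).
pose V n (s : {ffun 'I_n.+1 -> bool}) z : R^o := \sum_i (-1) ^+ s i * g i z.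
have cV n s : continuous (@V n s).
  move=> z; apply: cvg_big => [|i _]; first exact: (@add_continuous R^o).
  by apply: cvgM; [exact: cvg_cst|exact: cg].
pose v n s : sup_cts R cptY := mkcts (@cV n s).
have nz n (s : {ffun 'I_n.+1 -> bool}) z (i : 'I_n.+1) :
    ((-1) ^+ s i * g i z != 0) = (g i z != 0).
  by rewrite mulrI_eq0 ?signr_eq0//; apply: lregP; rewrite signr_eq0.
have dV n (s : {ffun 'I_n.+1 -> bool}) z (i j : 'I_n.+1) :
    (-1) ^+ s i * g i z != 0 -> (-1) ^+ s j * g j z != 0 -> i = j.
  by rewrite !nz => gi gj; apply: val_inj; exact: dg gi gj.
have N0 n : 0 < n.+1%:R :> R by rewrite ltr0n.
exists p, v; split.
- by move=> n; apply/card_gt0P; exists [ffun=> false].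
- move=> n s; split.
    move=> k w1 w2; rewrite /p.
    transitivity (n.+1%:R^-1 * (k * (\sum_i (-1) ^+ s i * w1 (y i)) +
      \sum_i (-1) ^+ s i * w2 (y i)) : R); last by rewrite mulrDr mulrCA.
    congr (_ * _); rewrite mulr_sumr -big_split/=; apply: eq_bigr => i _.
    by rewrite ctsD ctsZ mulrDr mulrCA.
  move=> w; rewrite normrM normfV (gtr0_norm (N0 n)) ler_pdivrMl//.
  rewrite (le_trans (ler_norm_sum _ _ _))//.
  rewrite -[n.+1 in X in _ <= X]card_ord mulr_natl -sumr_const.
  apply: ler_sum => i _; rewrite normrM normr_sign mul1r.
  exact: ler_sup_norm.
- move=> n s; split.
    apply: sup_norm_le => // z.
    have := sum_disjoint (dV n s z); rewrite -/(V n s z) => -[Vz|[i _ Vz]].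
      by rewrite [v n s z]Vz normr0.
    by rewrite [v n s z]Vz normrM normr_sign mul1r.
  rewrite /p (eq_bigr (fun=> 1)) => [|i _].
    by rewrite sumr_const card_ord mulVf// gt_eqF.
  rewrite [v n s (y i)](sum_disjoint_nz (dV n s (y i)) (i := i)).
    by rewrite gy mulr1 -expr2 sqrr_sign.
  by rewrite nz gy oner_neq0.
- move=> w; apply: (@signed_average_cvg0 R (fun n => w (y n)) `|w|) => n.
  exact: ler_sup_norm.
Qed.

Theorem corollary6p9 (R : realType) (X Y : topologicalType)
  (tychX : tychonoff_space X) (infX : infinite_set [set: X])
  (tychY : tychonoff_space Y) (infY : infinite_set [set: Y])
  (cptY : compact [set: Y]) :
  isomorphic R (Cp X (sup_cts R cptY)) (Cp X (sup_cts R cptY) * R^o)%type.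
Proof.
have [y [g [cg bg gy dg]]] := disjoint_bumps R tychY infY.
have [p [v pv]] := null_blocks_sup_cts cptY cg bg gy dg.
have [tb|] := pselect (forall h : Cp X (sup_cts R cptY),
    totally_bounded_range (h : X -> sup_cts R cptY)).
  have [x [f [cf bf fx df]]] := disjoint_bumps R tychX infX.
  exact: isomorphic_of_totally_bounded pv cf bf fx df tb.
move=> /existsNP[h /not_totally_bounded_separated[eps [x [eps0 sepx]]]].
have [_ lbp vP _] := pv.
have [lp bp] := lbp 0%N [ffun=> false].
exact: isomorphic_of_separated lp bp (vP _ _).2 eps0 sepx.
Qed.
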